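(* There exist absolute constants $c,c_1,c_2,\epsilon_0>0$ such that for every $\epsilon\in(0,\epsilon_0)$ the following holds: if a (possibly randomized) allocator for the Memory Reallocation problem with load factor $1-\epsilon$ guarantees, for every $M\in\mathbb{Z}^+$ and every update sequence fixed in advance with load factor $1-\epsilon$ in which all object sizes lie in $[c_1\epsilon^{3/7}M,\ c_2\epsilon^{3/7}M]$, that each update's squared overhead factor has expectation at most $g(\epsilon)$, then $g(\epsilon)\ge c\,\epsilon^{-1/7}$.
   Context: Memory Reallocation problem: the memory consists of $M$ slots indexed $0,\dots,M-1$; there is a dynamically changing set $X$ of live objects with sizes $\mu(x)\in\mathbb{Z}^+$. An allocation is a map $\phi\colon X\to\{0,\dots,M-1\}$ with $\phi(x)+\mu(x)\le M$ and the intervals $[\phi(x),\phi(x)+\mu(x))$ pairwise disjoint. Starting from $X=\varnothing$, updates (insert a new object of given size, or delete a live object) arrive online; after each update the allocator outputs an allocation of the new set $X'$, possibly moving existing objects. If the update inserts/deletes $x$ and the allocation changes from $\phi$ to $\phi'$, the overhead factor is $1+\frac{1}{\mu(x)}\sum_{y\in X\cap X',\ \phi(y)\ne\phi'(y)}\mu(y)$, and the squared overhead is its square. An update sequence has load factor $1-\epsilon$ if at all times $\sum_{x\in X}\mu(x)\le(1-\epsilon)M$. Expectations are over the allocator's randomness, with the update sequence fixed in advance (oblivious adversary). *)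

(* Defs.v *)
From HB Require Import structures.
From mathcomp Require Import all_boot all_order all_algebra.
From mathcomp Require Import finmap.
From mathcomp Require Import all_classical all_reals all_analysis.

Set Implicit Arguments.
Unset Strict Implicit.
Unset Printing Implicit Defensive.

Import Order.TTheory GRing.Theory Num.Theory.
Local Open Scope ring_scope.

(* An object is a pair (name, size); the name only serves to tell apart
   distinct objects of equal size. *)
Definition object := (nat * nat)%type.
Definition mu (x : object) : nat := x.2.

Variant update := Insert of object | Delete of object.

Definition updated (u : update) : object :=
  match u with Insert x => x | Delete x => x end.

Definition step (X : {fset object}) (u : update) : {fset object} :=
  match u with Insert x => (x |` X)%fset | Delete x => (X `\ x)%fset end.

(* Update sequences are listed in chronological order. *)
Definition live (s : seq update) : {fset object} := foldl step fset0 s.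

Definition legal (h : seq update) (u : update) : Prop :=
  match u with
  | Insert x => (0 < mu x)%N /\ x \notin map updated h
  | Delete x => x \in live h
  end.

Definition update_sequence (s : seq update) : Prop :=
  forall h u r, s = h ++ u :: r -> legal h u.

Definition has_load_factor (R : realType) (M : nat) (lambda : R)
    (s : seq update) : Prop :=
  forall h r, s = h ++ r -> \sum_(x <- live h) (mu x)%:R <= lambda * M%:R.

Definition sizes_within (R : realType) (a b : R) (s : seq update) : Prop :=
  forall x, x \in map updated s -> a <= (mu x)%:R <= b.

Definition occupies (phi : object -> nat) (x : object) (i : nat) : Prop :=
  (phi x <= i < phi x + mu x)%N.

(* Only the values of phi on X are meaningful. *)
Definition is_allocation (M : nat) (X : {fset object}) (phi : object -> nat) :
    Prop :=
  (forall x, x \in X -> (phi x < M)%N /\ (phi x + mu x <= M)%N) /\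
  (forall x y, x \in X -> y \in X -> x <> y ->
     forall i, ~ (occupies phi x i /\ occupies phi y i)).

(* [A M s w] is the allocation of [live s] output in a memory with M slots right
   after the updates s, when the random outcome is w: it depends on the updates
   received so far, and not on later ones. *)
Definition strategy (T : Type) := nat -> seq update -> T -> object -> nat.

Definition is_allocator (R : realType) (lambda : R)
    (d : measure_display) (T : measurableType d) (A : strategy T) : Prop :=
  forall M s, (0 < M)%N -> update_sequence s -> has_load_factor M lambda s ->
    (forall w, is_allocation M (live s) (A M s w)) /\
    (forall x k, x \in live s -> measurable [set w | A M s w x = k]%classic).

Definition overhead (R : realType) (T : Type) (A : strategy T) (M : nat)
    (h : seq update) (u : update) (w : T) : R :=
  let phi := A M h w in
  let phi' := A M (rcons h u) w in
  1 + (mu (updated u))%:R^-1 *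
      \sum_(y <- (live h `&` live (rcons h u))%fset | phi y != phi' y) (mu y)%:R.

(* Main.v *)
Require Import Defs.
From HB Require Import structures.
From mathcomp Require Import all_boot all_order all_algebra.
From mathcomp Require Import finmap zify ring lra.
From mathcomp Require Import all_classical all_reals all_analysis.
From mathcomp Require Import measurable_realfun.

(* Fill a memory, up to one free slot, with n objects of sizes 2(n+1) + 2v,
   where the excesses v sum to n. The address of an object then determines its
   rank i and the sum P(i) of the excesses of the objects below it. Start from n
   objects of excess 1, where P(i) = i, and repeatedly replace two objects of
   excesses p and q by objects of excesses p + q and 0, following a binary heap,
   until one object carries all the excess, where P(i) is 0 or n. This forces a
   total variation of P of order n^2. A replacement that displaces k objects
   changes P at no more than k ranks, by at most k times the largest excess
   alive, which is O(n/i) when heap node i is created; so the sum over i of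
   (n/i) k_i^2 is of order at least n^2. Taking expectations, the squared
   overhead is at least of order n / log n for some update, while the sizes are
   of order M/n. For n of order eps^(-3/7) this is more than eps^(-1/7). *)

Set Implicit Arguments.
Unset Strict Implicit.
Unset Printing Implicit Defensive.

Import Order.TTheory GRing.Theory Num.Theory.

(** * Tight allocations *)

Section Allocations.
Variables (M : nat) (X : {fset object}) (phi : object -> nat).
Hypothesis alloc : is_allocation M X phi.
Hypothesis mu_gt0 : forall x, x \in X -> 0 < mu x.

Lemma allocation_disjoint x y :
  x \in X -> y \in X -> phi x < phi y -> phi x + mu x <= phi y.
Proof.
move=> xX yX ltxy; rewrite leqNgt; apply/negP => overlap.
have nxy : x <> y by move=> exy; rewrite exy ltnn in ltxy.
apply: (alloc.2 x y xX yX nxy (phi y)).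
by split; rewrite /occupies; have := mu_gt0 yX; lia.
Qed.

Lemma allocation_inj : {in X &, injective phi}.
Proof.
move=> x y xX yX exy; apply: contrapT => nxy.
apply: (alloc.2 x y xX yX nxy (phi x)).
by have [mux muy] := (mu_gt0 xX, mu_gt0 yX); split; rewrite /occupies; lia.
Qed.

Lemma sum_size_within (p : pred object) lo hi :
  (forall x, x \in X -> p x -> lo <= phi x /\ phi x + mu x <= hi) ->
  \sum_(x <- X | p x) mu x <= hi - lo.
Proof.
move=> within; rewrite -big_filter; set s := [seq x <- X | p x].
have sX x : x \in s -> x \in X by rewrite mem_filter => /andP[].
pose slots := [seq i | x <- s, i <- iota (phi x) (mu x)].
have slots_uniq : uniq slots.
  apply: allpairs_uniq_dep => [|x _|]; rewrite ?iota_uniq //.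
    exact/filter_uniq/fset_uniq.
  move=> _ _ /allpairsPdep[x [i [xs xi ->]]] /allpairsPdep[y [j [ys yj ->]]].
  rewrite /= => eij; rewrite {}eij mem_iota in xi *.
  suff -> : x = y by []; apply: contrapT => nxy.
  by apply: (alloc.2 x y (sX x xs) (sX y ys) nxy j); rewrite mem_iota in yj.
have slots_within : {subset slots <= iota lo (hi - lo)}.
  move=> _ /allpairsPdep[x [i [xs xi ->]]].
  have [xX px] : x \in X /\ p x by apply/andP; rewrite andbC -mem_filter.
  by have := within x xX px; move: xi; rewrite !mem_iota; lia.
have := uniq_leq_size slots_uniq slots_within.
rewrite size_iota size_allpairs_dep sumnE big_map.
by under eq_bigr do rewrite size_iota.
Qed.

Lemma sum_size_below x :
  x \in X -> \sum_(y <- X | phi y < phi x) mu y <= phi x.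
Proof.
move=> xX; rewrite -[leqRHS]subn0; apply: sum_size_within => y yX ltyx.
by split=> //; apply: allocation_disjoint.
Qed.

Lemma sum_size_above x :
  x \in X -> \sum_(y <- X | phi x <= phi y) mu y <= M - phi x.
Proof.
move=> xX; apply: sum_size_within => y yX lexy.
by split=> //; have [] := alloc.1 y yX.
Qed.

End Allocations.

Definition excess (e : nat) (x : object) : nat := (mu x)./2 - e.+1.

Definition cell (e : nat) (phi : object -> nat) (x : object) : nat :=
  phi x %/ (e.+1).*2.

Definition profile (e : nat) (X : {fset object}) (phi : object -> nat)
    (i : nat) : nat :=
  \sum_(x <- X | cell e phi x < i) excess e x.

Definition tight_size (k e : nat) : nat := (k * e.+1 + e).*2.

Record tight (k e : nat) (X : {fset object}) : Prop := Tight {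
  tight_card : #|` X| = k;
  tight_excess : \sum_(x <- X) excess e x = e;
  tight_mu : forall x, x \in X -> mu x = (e.+1 + excess e x).*2 }.

Section TightAllocations.
Variables (k e : nat) (X : {fset object}) (phi : object -> nat).
Hypothesis tX : tight k e X.
Hypothesis alloc : is_allocation (tight_size k e).+1 X phi.

Lemma tight_mu_gt0 x : x \in X -> 0 < mu x.
Proof. by move=> xX; rewrite (tight_mu tX xX); lia. Qed.

Lemma tight_sum_mu (p : pred object) :
  \sum_(x <- X | p x) mu x =
    count p X * (e.+1).*2 + (\sum_(x <- X | p x) excess e x).*2.
Proof.
rewrite -sum1_count big_distrl /= -[X in _ + X]muln2 big_distrl /= -big_split.
rewrite big_seq_cond [RHS]big_seq_cond; apply: eq_bigr => x /andP[xX _].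
by rewrite [LHS](tight_mu tX xX) /=; lia.
Qed.

Lemma ltn_cell x y :
  x \in X -> y \in X -> (cell e phi x < cell e phi y) = (phi x < phi y).
Proof.
move=> xX yX; apply/idP/idP => [|lt].
  by apply: contraTT; rewrite -!leqNgt; apply: leq_div2r.
have le := allocation_disjoint alloc tight_mu_gt0 xX yX lt.
have -> : (cell e phi x).+1 = (phi x + (e.+1).*2) %/ (e.+1).*2.
  by rewrite divnDr // divnn addn1.
by apply: leq_div2r; apply: leq_trans le; rewrite (tight_mu tX xX); lia.
Qed.

Lemma tight_total_mu : \sum_(x <- X) mu x = tight_size k e.
Proof.
rewrite (tight_sum_mu xpredT) count_predT (tight_excess tX).
by rewrite -[size X]/(#|` X|) (tight_card tX) /tight_size; lia.
Qed.

(* At most one slot is free. As the excesses sum to e, the quotient of [phi x]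
   by 2(e+1) is then the rank of x, and half of the remainder is the sum of the
   excesses of the objects below x. *)
Lemma tight_address x : x \in X ->
  \sum_(y <- X | phi y < phi x) mu y <= phi x <=
    (\sum_(y <- X | phi y < phi x) mu y).+1.
Proof.
move=> xX; have := sum_size_below alloc tight_mu_gt0 xX.
have := sum_size_above alloc xX; under eq_bigl do rewrite leqNgt.
have := tight_total_mu; rewrite (bigID (fun y => phi y < phi x)) /=.
set before := \sum_(y <- X | phi y < phi x) mu y.
set after := \sum_(y <- X | _) _.
by have := (alloc.1 x xX).1; lia.
Qed.

Lemma leq_tight_excess (p : pred object) : \sum_(x <- X | p x) excess e x <= e.
Proof. by rewrite -[leqRHS](tight_excess tX) [leqRHS](bigID p) leq_addr. Qed.

Lemma cell_rank x : x \in X ->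
  cell e phi x = count (fun y => phi y < phi x) X.
Proof.
move=> xX; apply/eqP; rewrite eqn_leq -ltnS ltn_divLR // leq_divRL //.
have := leq_tight_excess (fun y => phi y < phi x).
have := tight_address xX; rewrite tight_sum_mu.
by set rank := count _ _; set E := \sum_(y <- X | _) excess e y; lia.
Qed.

Lemma profile_cell x : x \in X ->
  profile e X phi (cell e phi x) = (phi x %% (e.+1).*2)./2.
Proof.
move=> xX.
have -> : profile e X phi (cell e phi x) =
    \sum_(y <- X | phi y < phi x) excess e y.
  rewrite /profile big_seq_cond [RHS]big_seq_cond; apply: eq_bigl => y.
  by case: (boolP (y \in X)) => //= yX; rewrite ltn_cell.
have := tight_address xX; rewrite tight_sum_mu -cell_rank //.
by rewrite {2 3}(divn_eq (phi x) (e.+1).*2) -/(cell e phi x); lia.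
Qed.

Lemma perm_cells : perm_eq (map (cell e phi) X) (iota 0 k).
Proof.
have cells_uniq : uniq (map (cell e phi) X).
  rewrite map_inj_in_uniq ?fset_uniq // => x y xX yX exy.
  have := (ltn_cell xX yX, ltn_cell yX xX); rewrite exy ltnn => -[ltxy ltyx].
  by apply: (allocation_inj alloc tight_mu_gt0) => //; lia.
have cells_sub : {subset map (cell e phi) X <= iota 0 k}.
  move=> _ /mapP[x xX ->]; rewrite mem_iota cell_rank // -(tight_card tX).
  rewrite -[#|` X|]/(size X) -(count_predC (fun y => phi y < phi x)) /=.
  rewrite -addn1 leq_add2l -has_count.
  by apply/hasP; exists x; rewrite /= ?ltnn.
have sizes : size (iota 0 k) <= size (map (cell e phi) X).
  by rewrite size_iota size_map -(tight_card tX).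
apply: uniq_perm => //; first exact: iota_uniq.
by have [] := uniq_min_size cells_uniq cells_sub sizes.
Qed.

Lemma sum_cells (P : pred nat) (F : nat -> nat) :
  \sum_(x <- X | P (cell e phi x)) F (cell e phi x) =
    \sum_(0 <= i < k | P i) F i.
Proof.
by rewrite /index_iota subn0 -(perm_big _ perm_cells) big_map.
Qed.

Lemma profile_unit_excess i :
  {in X, forall x, excess e x = 1} -> i <= k -> profile e X phi i = i.
Proof.
move=> excess1 leik; rewrite /profile big_seq_cond.
rewrite (eq_bigr (fun=> 1)) => [|x /andP[xX _]]; last exact: excess1.
rewrite -big_seq_cond (sum_cells (fun j => j < i) (fun=> 1)).
rewrite -[RHS]muln1 -[in RHS](subn0 i) -sum_nat_const_nat.
by rewrite [RHS](big_nat_widen _ _ k).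
Qed.

Lemma profile_single_excess x0 i :
  {in X, forall x, x != x0 -> excess e x = 0} ->
  profile e X phi i = 0 \/ profile e X phi i = e.
Proof.
move=> excess0.
have sum0 (p : pred object) :
    ~~ p x0 -> \sum_(x <- X | p x) excess e x = 0.
  move=> npx0; apply: big1_seq => x /andP[px xX]; apply: excess0 => //.
  by apply: contraNneq npx0 => <-.
case: (boolP (cell e phi x0 < i)) => [lt|nlt]; [right|left]; last exact: sum0.
rewrite -[RHS](tight_excess tX) [RHS](bigID (fun x => cell e phi x < i)) /=.
by rewrite [X in _ = _ + X]sum0 ?lt // addn0.
Qed.

End TightAllocations.

(** * Displaced objects *)

Definition unmoved (X X' : {fset object}) (phi phi' : object -> nat) :
    {fset object} :=
  [fset x in X | (x \in X') && (phi x == phi' x)]%fset.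

Definition displaced (X X' : {fset object}) (phi phi' : object -> nat) :
    {fset object} :=
  (X `\` unmoved X X' phi phi')%fset.

Lemma in_unmoved X X' phi phi' x :
  (x \in unmoved X X' phi phi') = [&& x \in X, x \in X' & phi x == phi' x].
Proof. by rewrite !inE. Qed.

Lemma in_displaced X X' phi phi' x :
  (x \in displaced X X' phi phi') =
    (x \in X) && ((x \notin X') || (phi x != phi' x)).
Proof.
by rewrite in_fsetD in_unmoved; case: (x \in X); rewrite /= ?andbT ?negb_and.
Qed.

Lemma displacedxx X phi : displaced X X phi phi = fset0.
Proof.
by apply/fsetP => x; rewrite in_displaced eqxx orbF andbN in_fset0.
Qed.

Lemma displaced_trans X X' X'' phi phi' phi'' :
  (displaced X X'' phi phi'' `<=`
     displaced X X' phi phi' `|` displaced X' X'' phi' phi'')%fset.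
Proof.
apply/fsubsetP => x; rewrite in_fsetU !in_displaced.
case: (x \in X) => //=; case: (x \in X') => //=.
by case: (phi x =P phi' x) => //= ->.
Qed.

Lemma card_displaced_chain (X : nat -> {fset object})
    (phi : nat -> object -> nat) m :
  #|` displaced (X 0) (X m) (phi 0) (phi m)| <=
    \sum_(r < m) #|` displaced (X r) (X r.+1) (phi r) (phi r.+1)|.
Proof.
elim: m => [|m IH]; first by rewrite displacedxx cardfs0.
rewrite big_ord_recr /=; apply: leq_trans (leq_add IH (leqnn _)).
apply: leq_trans (leq_card_fsetU _ _).1.
exact/fsubset_leq_card/displaced_trans.
Qed.

Lemma leq_profile e w X phi i : {in X, forall x, excess e x <= w} ->
  profile e X phi i <= #|` X| * w.
Proof.
move=> lew; rewrite -[#|` X|]/(size X) -sum1_size big_distrl /=.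
rewrite /profile big_mkcond !big_seq; apply: leq_sum => x xX.
by rewrite mul1n; case: ifP => // _; apply: lew.
Qed.

Lemma profile_fsetD e X U phi i : (U `<=` X)%fset ->
  profile e X phi i = profile e U phi i + profile e (X `\` U)%fset phi i.
Proof.
move=> UX; rewrite /profile (big_fsetIDcond _ (mem U)).
congr (_ + _); apply/perm_big/uniq_perm; rewrite ?fset_uniq // => x.
  by rewrite !inE; apply: andb_idl; apply: (fsubsetP UX).
by rewrite !inE andbC.
Qed.

Section ProfileVariation.
Variables (k e w : nat) (X X' : {fset object}) (phi phi' : object -> nat).
Hypotheses (tX : tight k e X) (tX' : tight k e X').
Hypothesis alloc : is_allocation (tight_size k e).+1 X phi.
Hypothesis alloc' : is_allocation (tight_size k e).+1 X' phi'.
Hypothesis excess_le : {in X, forall x, excess e x <= w}.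
Hypothesis excess_le' : {in X', forall x, excess e x <= w}.

Let U := unmoved X X' phi phi'.
Let D := displaced X X' phi phi'.

Let subUX : (U `<=` X)%fset.
Proof. by apply/fsubsetP => x; rewrite in_unmoved => /andP[]. Qed.

Let subUX' : (U `<=` X')%fset.
Proof. by apply/fsubsetP => x; rewrite in_unmoved => /and3P[]. Qed.

Let card_fsetD_unmoved : #|` X' `\` U|%fset = #|` D|.
Proof.
by rewrite !cardfsDS // (tight_card tX) (tight_card tX').
Qed.

Let cell_unmoved x : x \in U -> cell e phi x = cell e phi' x.
Proof. by rewrite in_unmoved /cell => /and3P[_ _ /eqP->]. Qed.

Lemma profile_cell_unmoved x : x \in U ->
  profile e X phi (cell e phi' x) = profile e X' phi' (cell e phi' x).
Proof.
move=> xU; have [xX xX'] := (fsubsetP subUX _ xU, fsubsetP subUX' _ xU).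
rewrite -{1}cell_unmoved // (profile_cell tX) ?(profile_cell tX') //.
by move: xU; rewrite in_unmoved => /and3P[_ _ /eqP->].
Qed.

Lemma leq_dist_profile i :
  `|profile e X phi i - profile e X' phi' i| <= #|` D| * w.
Proof.
rewrite (profile_fsetD _ _ _ subUX) (profile_fsetD _ _ _ subUX').
have -> : profile e U phi i = profile e U phi' i.
  rewrite /profile big_seq_cond [RHS]big_seq_cond; apply: eq_bigl => x.
  by case: (boolP (x \in U)) => //= xU; rewrite cell_unmoved.
rewrite distnDl.
have := @leq_profile e w (X `\` U)%fset phi i
  (sub_in1 (fsubsetP (fsubsetDl _ _)) excess_le).
have := @leq_profile e w (X' `\` U)%fset phi' i
  (sub_in1 (fsubsetP (fsubsetDl _ _)) excess_le').
by rewrite card_fsetD_unmoved -/(displaced X X' phi phi') -/D; lia.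
Qed.

(* An unmoved object keeps its cell and the profile there, so the profile
   changes at no more ranks than there are displaced objects. *)
Lemma profile_variation :
  \sum_(0 <= i < k) `|profile e X phi i - profile e X' phi' i| <=
    #|` D| ^ 2 * w.
Proof.
pose F i := `|profile e X phi i - profile e X' phi' i|%N.
rewrite -(sum_cells tX' alloc' xpredT F) /=.
rewrite -(big_fset_incl _ (fsubsetDl X' U)) => [|x xX' xND]; last first.
  have xU : x \in U by move: xND; rewrite in_fsetD xX' andbT negbK.
  by rewrite /F profile_cell_unmoved // distnn.
apply: leq_trans (leq_sum _ (fun x _ => leq_dist_profile _)) _.
by rewrite big_const_seq count_predT iter_addn_0 card_fsetD_unmoved mulnC mulnA.
Qed.

End ProfileVariation.

(** * Update sequences *)

Lemma live_rcons s u : live (rcons s u) = step (live s) u.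
Proof. by rewrite /live foldl_rcons. Qed.

Lemma live_updated s x : x \in live s -> x \in map updated s.
Proof.
elim/last_ind: s => [//|s u IH]; rewrite live_rcons map_rcons mem_rcons inE.
case: u => z /=; first by rewrite in_fset1U => /orP[->//|/IH ->]; rewrite orbT.
by rewrite in_fsetD1 => /andP[_ /IH ->]; rewrite orbT.
Qed.

Lemma perm_fset1U (K : choiceType) (x : K) (X : {fset K}) (r : seq K) :
  x \notin X -> perm_eq X r -> perm_eq (x |` X)%fset (x :: r).
Proof.
move=> nxX pXr; apply: (@perm_trans _ (x :: X)); last by rewrite perm_cons.
by apply: uniq_perm; rewrite /= ?nxX ?fset_uniq // => y; rewrite !inE.
Qed.

Lemma perm_fsetD1 (K : choiceType) (x : K) (X : {fset K}) (r : seq K) :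
  perm_eq X (x :: r) -> perm_eq (X `\ x)%fset r.
Proof.
move=> pXr; have /andP[nxr ur] : uniq (x :: r).
  by rewrite -(perm_uniq pXr) fset_uniq.
apply: uniq_perm; rewrite ?fset_uniq // => y.
rewrite in_fsetD1 (perm_mem pXr) inE.
by case: eqP => [->|] //=; rewrite (negbTE nxr).
Qed.

Section Runs.
Variables L lo hi : nat.

Record admissible (s : seq update) : Prop := Admissible {
  admissible_seq : update_sequence s;
  admissible_load : forall h r, s = h ++ r -> \sum_(x <- live h) mu x <= L;
  admissible_size : forall x, x \in map updated s -> lo <= mu x <= hi }.

Record run (s : seq update) (r : seq object) : Prop := Run {
  run_admissible : admissible s;
  run_live : perm_eq (live s) r }.

Lemma admissible_nil : admissible [::].
Proof.
split=> [[|? ?] //|[|? ?] // [|? ?] // _|//].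
by rewrite /live /= big_seq_fset0.
Qed.

Lemma admissible_rcons s u :
  admissible s -> legal s u -> \sum_(x <- live (rcons s u)) mu x <= L ->
  lo <= mu (updated u) <= hi -> admissible (rcons s u).
Proof.
move=> [seq_s load_s size_s] legal_u load_u size_u; split.
- move=> h v r; case/lastP: r => [|r z].
    by rewrite cats1 => /rcons_inj[<- <-].
  by rewrite -rcons_cons -rcons_cat => /rcons_inj[/seq_s].
- move=> h r; case/lastP: r => [|r z]; first by rewrite cats0 => <-.
  by rewrite -rcons_cat => /rcons_inj[/load_s].
- by move=> x; rewrite map_rcons mem_rcons inE => /orP[/eqP->|/size_s].
Qed.

Lemma admissible_prefix s r : admissible (s ++ r) -> admissible s.
Proof.
move=> [seq_sr load_sr size_sr]; split=> [h u t es|h t es|x xs].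
- by apply: (seq_sr h u (t ++ r)); rewrite es -catA.
- by apply: (load_sr h (t ++ r)); rewrite es -catA.
- by apply: size_sr; rewrite map_cat mem_cat xs.
Qed.

Lemma run_nil : run [::] [::].
Proof.
split; first exact: admissible_nil.
by apply: uniq_perm => [|//|x]; rewrite ?fset_uniq // in_fset0.
Qed.

Lemma run_perm s r r' : perm_eq r r' -> run s r -> run s r'.
Proof. by move=> prr' [adm pr]; split=> //; apply: perm_trans pr prr'. Qed.

Lemma run_load s r : run s r -> \sum_(x <- r) mu x <= L.
Proof.
move=> [adm pr]; rewrite -(perm_big _ pr).
by apply: (admissible_load adm (r := [::])); rewrite cats0.
Qed.

Lemma run_insert s r x :
  0 < lo -> run s r -> x \notin map updated s -> lo <= mu x <= hi ->
  mu x + \sum_(y <- r) mu y <= L -> run (rcons s (Insert x)) (x :: r).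
Proof.
move=> lo0 [adm pr] fresh size_x load_x.
have pxr : perm_eq (live (rcons s (Insert x))) (x :: r).
  by rewrite live_rcons perm_fset1U //; apply: contra fresh => /live_updated.
split=> //; apply: admissible_rcons => //; first by split; [lia|].
by rewrite (perm_big _ pxr) big_cons.
Qed.

Lemma run_delete s r x : run s (x :: r) -> run (rcons s (Delete x)) r.
Proof.
move=> run_s; have [adm pr] := run_s.
have pr' : perm_eq (live (rcons s (Delete x))) r.
  by rewrite live_rcons perm_fsetD1.
have xs : x \in live s by rewrite (perm_mem pr) mem_head.
split=> //; apply: admissible_rcons => //.
- rewrite (perm_big _ pr'); apply: leq_trans (run_load run_s).
  by rewrite big_cons leq_addl.
- exact/(admissible_size adm)/live_updated.
Qed.

Lemma run_inserts r :
  0 < lo -> uniq r -> {in r, forall x, lo <= mu x <= hi} ->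
  \sum_(x <- r) mu x <= L -> run (map Insert r) r.
Proof.
move=> lo0; elim/last_ind: r => [|r x IH] r_uniq size_r load_r.
  exact: run_nil.
rewrite map_rcons; apply: (@run_perm _ (x :: r)).
  by rewrite perm_sym perm_rcons.
move: r_uniq load_r; rewrite rcons_uniq big_rcons => /andP[nxr r_uniq] load_r.
apply: run_insert => //.
- apply: IH => // [y yr|]; last exact: leq_trans (leq_addr _ _) load_r.
  by apply: size_r; rewrite mem_rcons inE yr orbT.
- by rewrite -map_comp map_id.
- by apply: size_r; rewrite mem_rcons mem_head.
- by rewrite addnC.
Qed.

Definition replacement (x y x' y' : object) : seq update :=
  [:: Delete x; Delete y; Insert x'; Insert y'].

Lemma run_replacement s r x y x' y' :
  0 < lo -> run s [:: x, y & r] ->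
  x' \notin map updated s -> y' \notin map updated s -> x' != y' ->
  lo <= mu x' <= hi -> lo <= mu y' <= hi -> mu x' + mu y' = mu x + mu y ->
  run (s ++ replacement x y x' y') [:: y', x' & r].
Proof.
move=> lo0 run_s x'_fresh y'_fresh nx'y' size_x' size_y' mu_eq.
have load := run_load run_s; rewrite !big_cons in load.
have xs z : z \in [:: x; y] -> z \in map updated s.
  move=> zxy; apply: live_updated; rewrite (perm_mem (run_live run_s)).
  by rewrite (mem_cat z [:: x; y] r) zxy.
have nxs z : z \notin map updated s -> z != x /\ z != y.
  by move=> fresh; split; apply: contraNneq fresh => ->;
    rewrite xs // !in_cons eqxx ?orbT.
have [[nx'x nx'y] [ny'x ny'y]] := (nxs _ x'_fresh, nxs _ y'_fresh).
rewrite /replacement -!cat_rcons cats0.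
apply: run_insert => //; last by rewrite big_cons; lia.
  apply: run_insert => //; last by lia.
    by apply/run_delete/run_delete.
  by rewrite !map_rcons !(mem_rcons, in_cons) !negb_or nx'x nx'y.
by rewrite !map_rcons !(mem_rcons, in_cons) !negb_or ny'x ny'y eq_sym nx'y'.
Qed.

End Runs.

(** * Merging excesses along a heap *)

(* Heap with leaves n, ..., 2n - 1, the children of j being 2j and 2j + 1; f is
   fuel, sufficient when n - j <= f. *)
Fixpoint leaves (n f j : nat) : nat :=
  if f is f'.+1 then
    if n <= j then 1 else leaves n f' j.*2 + leaves n f' j.*2.+1
  else 1.

Definition weight (n j : nat) : nat := leaves n (n - j) j.

Lemma leaves_fuel n f f' j : 0 < j -> n - j <= f -> n - j <= f' ->
  leaves n f j = leaves n f' j.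
Proof.
elim: f f' j => [|f IH] [|f'] j j0 lef lef' //=; try by rewrite ifT //; lia.
by case: leqP => // ltjn; congr (_ + _); apply: IH; lia.
Qed.

Lemma weight_leaf n j : n <= j -> weight n j = 1.
Proof. by rewrite /weight -subn_eq0 => /eqP->. Qed.

Lemma weight_node n j : 0 < j < n ->
  weight n j = weight n j.*2 + weight n j.*2.+1.
Proof.
move=> /andP[j0 ltjn]; rewrite /weight -(subnSK ltjn) /= leqNgt ltjn /=.
by congr (_ + _); apply: leaves_fuel; lia.
Qed.

Lemma weight_bound n j : 0 < j < n.*2 -> weight n j * j <= n.*2.
Proof.
have [f] := ubnP (n - j); elim: f j => // f IH j lef j_bounds.
have [lenj|ltjn] := leqP n j; first by rewrite weight_leaf; lia.
have left := IH j.*2 ltac:(lia) ltac:(lia).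
have right := IH j.*2.+1 ltac:(lia) ltac:(lia).
by rewrite weight_node; nia.
Qed.

Lemma iota_rcons2 i :
  0 < i -> iota i.+1 i.+1 = iota i.+1 i.-1 ++ [:: i.*2; i.*2.+1].
Proof.
case: i => // i _; have := iotaD i.+2 i 2; rewrite addn2 => ->.
by congr (_ ++ [:: _; _]); lia.
Qed.

Lemma sum_weight n i : 0 < i <= n -> \sum_(j <- iota i i) weight n j = n.
Proof.
have [d] := ubnP (n - i); elim: d i => // d IH i led /andP[i0].
rewrite leq_eqVlt => /orP[/eqP->|ltin].
  rewrite (eq_big_seq (fun=> 1)) ?sum1_size ?size_iota // => j.
  by rewrite mem_iota => /andP[/weight_leaf].
have -> : iota i i = i :: iota i.+1 i.-1 by rewrite -{2}(prednK i0).
rewrite big_cons weight_node ?i0 // -[RHS](IH i.+1); try lia.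
by rewrite iota_rcons2 // big_cat !big_cons big_nil /= addn0 addnC.
Qed.

(* The half of a name is a heap index: names are fresh as long as the inner
   nodes are created in decreasing order. *)
Definition node (n j : nat) : object := (j.*2, (n.+1 + weight n j).*2).
Definition spare (n j : nat) : object := (j.*2.+1, (n.+1).*2).

Lemma excess_node n j : excess n (node n j) = weight n j.
Proof. by rewrite /excess /mu /=; lia. Qed.

Lemma excess_spare n j : excess n (spare n j) = 0.
Proof. by rewrite /excess /mu /=; lia. Qed.

Lemma node_size n j : 0 < j < n.*2 ->
  (n.+1).*2 <= mu (node n j) <= 3 * (n.+1).*2.
Proof.
by move=> j_bounds; have := weight_bound j_bounds; rewrite /mu /=; nia.
Qed.

Definition frontier (n i : nat) : seq object :=
  [seq node n j | j <- iota i i] ++ [seq spare n j | j <- iota i (n - i)].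

Definition memory (n : nat) : nat := (tight_size n n).+1.

Definition merge (n i : nat) : seq update :=
  replacement (node n i.*2) (node n i.*2.+1) (node n i) (spare n i).

Fixpoint merging (n t : nat) : seq update :=
  if t is t'.+1 then merging n t' ++ merge n (n - t)
  else [seq Insert x | x <- frontier n n].

Lemma mem_frontier n i x : x \in frontier n i ->
  (exists2 j, i <= j < i.*2 & x = node n j) \/
  (exists2 j, i <= j < n & x = spare n j).
Proof.
rewrite mem_cat => /orP[] /mapP[j]; rewrite mem_iota => j_bounds ->.
  by left; exists j; rewrite // -addnn.
by right; exists j => //; lia.
Qed.

Lemma sum_excess_frontier n i : 0 < i <= n ->
  \sum_(x <- frontier n i) excess n x = n.
Proof.
move=> i_bounds; rewrite big_cat !big_map /=.
under eq_bigr do rewrite excess_node.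
rewrite sum_weight // big1 ?addn0 // => j _; exact: excess_spare.
Qed.

Lemma frontier_uniq n i : uniq (frontier n i).
Proof.
rewrite cat_uniq !map_inj_in_uniq ?iota_uniq ?andbT /=; first last.
- by move=> j j' _ _ [/double_inj].
- by move=> j j' _ _ [/double_inj].
by apply/hasPn => _ /mapP[j _ ->]; apply/mapP => -[j' _ []]; lia.
Qed.

Lemma leq_name_merging n t x : t < n -> x \in map updated (merging n t) ->
  n - t <= x.1./2.
Proof.
elim: t => [|t IH] lttn.
  by rewrite -map_comp map_id => /mem_frontier[] [j j_bounds ->] /=; lia.
rewrite map_cat mem_cat => /orP[/IH|]; first by lia.
by rewrite !inE => /or4P[] /eqP->; rewrite /=; lia.
Qed.

Lemma perm_frontier_merge n i : 0 < i < n -> exists r,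
  perm_eq (frontier n i.+1) [:: node n i.*2, node n i.*2.+1 & r] /\
  perm_eq [:: spare n i, node n i & r] (frontier n i).
Proof.
move=> /andP[i0 ltin].
exists ([seq node n j | j <- iota i.+1 i.-1] ++
        [seq spare n j | j <- iota i.+1 (n - i.+1)]); split.
  rewrite /frontier iota_rcons2 // map_cat -catA /=.
  by rewrite -(cat1s _ (_ :: _)) -cat_rcons perm_catCA.
have iota_cons k : 0 < k -> iota i k = i :: iota i.+1 k.-1.
  by case: k.
rewrite /frontier (iota_cons i) // (iota_cons (n - i)) ?subn_gt0 // subnS /=.
exact/permEl/(perm_catCA [:: _] (_ :: _)).
Qed.

Lemma run_merging n t : t < n ->
  run (tight_size n n) (n.+1).*2 (3 * (n.+1).*2)
    (merging n t) (frontier n (n - t)).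
Proof.
elim: t => [|t IH] lttn.
  rewrite subn0 /=; apply: run_inserts => //; first exact: frontier_uniq.
    move=> x /mem_frontier[] [j j_bounds ->]; last by rewrite /mu /=; lia.
    by apply: node_size; lia.
  rewrite /frontier subnn cats0 big_map (eq_big_seq (fun=> (n.+2).*2)).
    by rewrite big_const_seq count_predT size_iota iter_addn_0 /tight_size; lia.
  move=> j; rewrite mem_iota /mu /= => /andP[/weight_leaf-> _].
  by rewrite addn1.
set i := n - t.+1; have i_bounds : 0 < i < n by lia.
have [r [pr pr']] := perm_frontier_merge i_bounds.
have fresh x : x.1./2 = i -> x \notin map updated (merging n t).
  by move=> xi; apply/negP => /(leq_name_merging (ltnW lttn)); lia.
apply: run_perm pr' _; rewrite /= -/i; apply: run_replacement => //.
- apply: run_perm pr _; rewrite /i subnSK; last exact: ltnW.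
  exact/IH/ltnW.
- by apply: fresh; rewrite /= doubleK.
- by apply: fresh; rewrite /=; lia.
- by apply/eqP => -[]; lia.
- by apply: node_size; lia.
- by rewrite /mu /=; lia.
- by rewrite /mu /= weight_node //; lia.
Qed.

Lemma live_merging n t : t < n ->
  perm_eq (live (merging n t)) (frontier n (n - t)).
Proof. by move/run_merging/run_live. Qed.

Lemma tight_merging n t : t < n -> tight n n (live (merging n t)).
Proof.
move=> lttn; have live_t := live_merging lttn; split.
- by rewrite (perm_size live_t) size_cat !size_map !size_iota; lia.
- by rewrite (perm_big _ live_t) sum_excess_frontier; lia.
- move=> x; rewrite (perm_mem live_t) => /mem_frontier[] [j _ ->].
    by rewrite excess_node.
  by rewrite excess_spare addn0.
Qed.

Lemma excess_merging n t x : t < n -> x \in live (merging n t) ->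
  excess n x <= n.*2 %/ (n - t).
Proof.
move=> lttn; rewrite (perm_mem (live_merging lttn)).
case/mem_frontier => [] [j j_bounds ->]; last by rewrite excess_spare.
rewrite excess_node leq_divRL; last by lia.
have := @weight_bound n j; nia.
Qed.

Lemma sum_mul_subn n : \sum_(0 <= i < n) i * (n - i) = 'C(n.+1, 3).
Proof.
elim: n => [|n IH]; first by rewrite big_geq.
rewrite big_nat_recr //= subSnn muln1 binS -IH -bin2_sum big_nat_recr //= addnA.
congr (_ + _); rewrite -big_split /=.
apply: eq_big_nat => i /andP[_ ltin].
by rewrite subSn ?mulnS 1?addnC // ltnW.
Qed.

Lemma expn3_bin n : n ^ 3 = n + 6 * 'C(n.+1, 3).
Proof.
case: n => // n; have := bin_ffact n.+2 3.
rewrite !ffactnS ffactn0 (_ : 3`! = 6) // !expnS expn0 /=.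
by set c := 'C(_, _); lia.
Qed.

Lemma leq_dist_sum (F : nat -> nat) m :
  `|F 0 - F m| <= \sum_(0 <= t < m) `|F t - F t.+1|.
Proof.
elim: m => [|m IH]; first by rewrite distnn.
rewrite big_nat_recr //=; apply: leq_trans (leqD_dist _ (F m) _) _.
by rewrite leq_add2r.
Qed.

Section MergingVariation.
Variables (n : nat) (phi : nat -> object -> nat).
Hypothesis n_gt0 : 0 < n.
Hypothesis alloc : forall t, t < n ->
  is_allocation (memory n) (live (merging n t)) (phi t).

Let P t i := profile n (live (merging n t)) (phi t) i.
Let D t := displaced (live (merging n t)) (live (merging n t.+1))
  (phi t) (phi t.+1).

Lemma merging_profile0 i : i <= n -> P 0 i = i.
Proof.
apply: (profile_unit_excess (tight_merging n_gt0) (alloc n_gt0)) => x.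
rewrite (perm_mem (live_merging n_gt0)) subn0 mem_cat subnn orbF.
case/mapP=> j; rewrite mem_iota => /andP[lenj _] ->.
by rewrite excess_node weight_leaf.
Qed.

Lemma merging_profile_last i : P n.-1 i = 0 \/ P n.-1 i = n.
Proof.
have ltn : n.-1 < n by lia.
apply: (@profile_single_excess n n _ _ (tight_merging ltn) (node n 1)) => x.
rewrite (perm_mem (live_merging ltn)) (_ : n - n.-1 = 1); last by lia.
case/mem_frontier => [] [j j_bounds ->]; last by rewrite excess_spare.
by rewrite (_ : j = 1) ?eqxx //; lia.
Qed.

Lemma merging_profile_variation t : t.+1 < n ->
  \sum_(0 <= i < n) `|P t i - P t.+1 i| <=
    #|` D t| ^ 2 * (n.*2 %/ (n - t.+1)).
Proof.
move=> ltSn; have ltn := ltnW ltSn.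
apply: profile_variation; do ?[exact: tight_merging | exact: alloc] => x x_live.
  apply: leq_trans (excess_merging ltn x_live) _.
  by apply: leq_div2l; lia.
exact: excess_merging x_live.
Qed.

Lemma mul_subn_le_dist_profile i :
  i <= n -> i * (n - i) <= n * `|P 0 i - P n.-1 i|.
Proof.
by move=> lein; rewrite merging_profile0 //;
  case: (merging_profile_last i) => ->; nia.
Qed.

Lemma merging_displaced_ge :
  n ^ 2 <= 1 + 6 * \sum_(t < n.-1) #|` D t| ^ 2 * (n.*2 %/ (n - t.+1)).
Proof.
set B := \sum_(t < _) _.
have total : \sum_(0 <= i < n) `|P 0 i - P n.-1 i| <= B.
  apply: (@leq_trans (\sum_(0 <= i < n) \sum_(t < n.-1) `|P t i - P t.+1 i|)).
    apply: leq_sum => i _.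
    rewrite -(big_mkord xpredT (fun t => `|P t i - P t.+1 i|%N)).
    exact: (leq_dist_sum (fun t => P t i)).
  rewrite exchange_big /=; apply: leq_sum => t _.
  by apply: merging_profile_variation; have := ltn_ord t; lia.
have : 'C(n.+1, 3) <= n * B.
  rewrite -sum_mul_subn; apply: leq_trans (leq_mul (leqnn n) total).
  rewrite big_distrr /= !big_nat; apply: leq_sum => i /andP[_ ltin].
  exact/mul_subn_le_dist_profile/ltnW.
have := expn3_bin n; rewrite expnS => cubic bin_le.
by rewrite -(leq_pmul2l n_gt0) cubic; lia.
Qed.

End MergingVariation.

Lemma merging_prefix n t k : t <= k -> exists r, merging n k = merging n t ++ r.
Proof.
move=> /subnK <-; elim: (k - t) => [|m [r merging_eq]].
  by exists [::]; rewrite cats0.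
by exists (r ++ merge n (n - (m + t).+1)); rewrite catA -merging_eq.
Qed.

(** * Overhead *)

Lemma card_displaced_update s u phi phi' :
  #|` displaced (live s) (live (rcons s u)) phi phi'| <=
    (count (fun y => phi y != phi' y) (live s `&` live (rcons s u))%fset).+1.
Proof.
rewrite -size_filter -[_.+1]/(size (updated u :: _)).
apply: uniq_leq_size => [|y]; first exact: fset_uniq.
rewrite in_displaced in_cons mem_filter in_fsetI => /andP[ys moved].
rewrite ys; case: (boolP (y \in live (rcons s u))) moved => [_ /= ->|ndel _].
  by rewrite orbT.
move: ndel; rewrite live_rcons; case: u => z /=.
  by rewrite in_fset1U ys orbT.
by rewrite in_fsetD1 ys andbT negbK => ->.
Qed.

Local Open Scope ring_scope.

Definition displaced_by (T : Type) (A : strategy T) (M : nat)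
    (s s' : seq update) (w : T) : {fset object} :=
  displaced (live s) (live s') (A M s w) (A M s' w).

Lemma card_displaced_overhead (R : realType) (T : Type) (A : strategy T)
    (M a C : nat) s u (w : T) :
  (0 < a)%N ->
  (forall x, x \in map updated (rcons s u) -> a <= mu x <= C * a)%N ->
  #|` displaced_by A M s (rcons s u) w|%:R <= C%:R * overhead R A M s u w.
Proof.
move=> a0 sizes; rewrite /overhead -natr_sum -big_filter.
set moved := [seq y <- _ | _].
have := card_displaced_update s u (A M s w) (A M (rcons s u) w).
rewrite -size_filter -/moved -/(displaced_by _ _ _ _ _) => displaced_le.
have [/andP[au uC]] : (a <= mu (updated u) <= C * a)%N.
  by apply: sizes; rewrite map_rcons mem_rcons mem_head.
have mu0 : (0 < mu (updated u))%N by exact: leq_trans au.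
have moved_le : (size moved * a <= \sum_(y <- moved) mu y)%N.
  rewrite -sum1_size big_distrl /= !big_seq; apply: leq_sum => y.
  rewrite mem_filter in_fsetI mul1n => /and3P[_ _ /live_updated].
  by case/sizes/andP.
rewrite -(ler_pM2r (_ : 0 < (mu (updated u))%:R)) ?ltr0n // -mulrA mulrDl.
rewrite mul1r mulrAC mulVf ?pnatr_eq0 -?lt0n // mul1r -natrD -!natrM ler_nat.
apply: leq_trans (leq_mul displaced_le (leqnn _)) _; rewrite mulSn mulnDr.
apply: leq_add; first by rewrite leq_pmull //; case: (C) uC; lia.
by apply: leq_trans (leq_mul (leqnn _) uC) _; rewrite mulnCA leq_mul.
Qed.

Lemma sqr_sum_le (R : realDomainType) (I : finType) (f : I -> R) :
  (\sum_i f i) ^+ 2 <= #|I|%:R * \sum_i f i ^+ 2.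
Proof.
rewrite -(ler_pM2l (ltr0n R 2)).
have -> : 2 * (#|I|%:R * \sum_i f i ^+ 2) =
    \sum_i \sum_j (f i ^+ 2 + f j ^+ 2).
  under [RHS]eq_bigr do rewrite big_split /= sumr_const.
  by rewrite big_split /= sumrMnl sumr_const -mulr_natl; ring.
rewrite expr2 big_distrlr mulr_sumr /=; apply: ler_sum => i _.
rewrite mulr_sumr; apply: ler_sum => j _.
by rewrite -subr_ge0; have := sqr_ge0 (f i - f j); lra.
Qed.

(* The default of [nth] is never reached. *)
Definition nth_update (us : seq update) (r : nat) : update :=
  nth (Delete (0, 0)%N) us r.

Lemma cat_take_update s us r : (r < size us)%N ->
  s ++ take r.+1 us = rcons (s ++ take r us) (nth_update us r).
Proof. by move=> lt; rewrite (take_nth (Delete (0, 0)%N)) // rcons_cat. Qed.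

Lemma sqr_displaced_overhead (R : realType) (T : Type) (A : strategy T)
    (M a C : nat) s us (w : T) :
  (0 < a)%N ->
  (forall x, x \in map updated (s ++ us) -> a <= mu x <= C * a)%N ->
  #|` displaced_by A M s (s ++ us) w|%:R ^+ 2 <=
    C%:R ^+ 2 * (size us)%:R *
      \sum_(r < size us)
        overhead R A M (s ++ take r us) (nth_update us r) w ^+ 2.
Proof.
move=> a0 sizes; pose h r := s ++ take r us.
pose o r := overhead R A M (h r) (nth_update us r) w.
have step_le r : (r < size us)%N ->
    #|` displaced_by A M (h r) (h r.+1) w|%:R <= C%:R * o r.
  move=> ltr; rewrite /h cat_take_update //.
  apply: (@card_displaced_overhead R T A M a) => // x.
  rewrite -cat_take_update // => xh; apply: sizes.
  by rewrite -(cat_take_drop r.+1 us) catA map_cat mem_cat xh.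
have total_le : #|` displaced_by A M s (s ++ us) w|%:R <=
    C%:R * \sum_(r < size us) o r.
  have := card_displaced_chain (fun r => live (h r)) (fun r => A M (h r) w)
    (size us).
  rewrite /h take0 cats0 take_size -(ler_nat R) natr_sum => /le_trans; apply.
  by rewrite mulr_sumr; apply: ler_sum => r _; apply: step_le.
apply: (@le_trans _ _ ((C%:R * \sum_(r < size us) o r) ^+ 2)).
  by rewrite lerXn2r ?nnegrE // (le_trans _ total_le).
rewrite exprMn -mulrA ler_wpM2l ?sqr_ge0 //.
by rewrite -[in (size us)%:R](card_ord (size us)) sqr_sum_le.
Qed.

Definition merge_history (n t r : nat) : seq update :=
  merging n t ++ take r (merge n (n - t.+1)).

Definition merge_update (n t r : nat) : update :=
  nth_update (merge n (n - t.+1)) r.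

Lemma merging_split_update n t r k : (r < 4)%N -> (t < k)%N ->
  exists s, merging n k = merge_history n t r ++ merge_update n t r :: s.
Proof.
move=> ltr4 lttk; have [s ->] := merging_prefix n lttk.
exists (drop r.+1 (merge n (n - t.+1)) ++ s).
rewrite -cat_rcons -cat_take_update //=.
by rewrite -[in LHS](cat_take_drop r.+1 (merge _ _)) !catA.
Qed.

Section MergingOverhead.
Variables (R : realType) (T : Type) (A : strategy T) (n : nat).

Definition merge_overhead (p : 'I_n.-1 * 'I_4) (w : T) : R :=
  overhead R A (memory n) (merge_history n p.1 p.2) (merge_update n p.1 p.2) w.

(* 432 = 6 * 2 * (3^2 * 4): the sizes differ by a factor of at most 3, and a
   merge consists of 4 updates. *)
Lemma merging_overhead_ge (w : T) :
  (0 < n)%N ->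
  (forall t, (t < n)%N ->
     is_allocation (memory n) (live (merging n t))
       (A (memory n) (merging n t) w)) ->
  n%:R ^+ 2 - 1 <=
    \sum_(p : 'I_n.-1 * 'I_4)
      432 * n%:R / (n - p.1.+1)%:R * merge_overhead p w ^+ 2.
Proof.
move=> n0 alloc; have := merging_displaced_ge n0 alloc.
rewrite -(ler_nat R) natrX natrD lerBlDl => /le_trans; apply; rewrite lerD2l.
rewrite natrM natr_sum mulr_sumr.
rewrite -(pair_bigA _ (fun (t : 'I_n.-1) (r : 'I_4) =>
  432 * n%:R / (n - t.+1)%:R * merge_overhead (t, r) w ^+ 2)) /=.
apply: ler_sum => t _; rewrite -mulr_sumr natrM natrX.
have ltSn : (t.+1 < n)%N by have := ltn_ord t; lia.
have := sqr_displaced_overhead R A (memory n) w (isT : 0 < (n.+1).*2)%N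
  (admissible_size (run_admissible (run_merging ltSn))).
rewrite -[size (merge _ _)]/4%N.
set displaced2 := _ ^+ 2; set S := \sum_(r < _) _ => displaced2_le.
have i0 : 0 < (n - t.+1)%:R :> R by rewrite ltr0n; lia.
have div_le : (n.*2 %/ (n - t.+1))%:R <= 2 * n%:R / (n - t.+1)%:R :> R.
  by rewrite ler_pdivlMr // -!natrM ler_nat mul2n; exact: leq_divM.
have := ler_pM (sqr_ge0 _) (ler0n _ _) displaced2_le div_le.
move=> /(ler_wpM2l (ler0n R 6)) /le_trans; apply.
by rewrite le_eqVlt; apply/orP; left; apply/eqP; field; rewrite lt0r_neq0.
Qed.

End MergingOverhead.

Lemma measurable_neq_nat (d : measure_display) (T : measurableType d)
    (f f' : T -> nat) :
  (forall k, measurable [set w | f w = k]%classic) ->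
  (forall k, measurable [set w | f' w = k]%classic) ->
  measurable [set w | f w <> f' w]%classic.
Proof.
move=> mf mf'.
have -> : ([set w | f w <> f' w] =
    \bigcup_k ([set w | f w = k] `\` [set w | f' w = k]))%classic.
  apply/seteqP; split=> [w /= neq|w [k _] [/= -> neq] e]; last exact: neq.
  by exists (f w) => //; split=> //= e; apply: neq.
by apply: bigcup_measurable => k _; apply: measurableD.
Qed.

Lemma measurable_overhead (R : realType) (d : measure_display)
    (T : measurableType d) (A : strategy T) M h u :
  (forall x k, x \in live h -> measurable [set w | A M h w x = k]%classic) ->
  (forall x k, x \in live (rcons h u) ->
     measurable [set w | A M (rcons h u) w x = k]%classic) ->
  measurable_fun setT (overhead R A M h u).
Proof.
move=> mh mhu; set X := (live h `&` live (rcons h u))%fset.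
pose moves y := [set w | A M h w y <> A M (rcons h u) w y]%classic.
have -> : overhead R A M h u = (fun w => 1 + (mu (updated u))%:R^-1 *
    \sum_(y <- X) if y \in X then (mu y)%:R * \1_(moves y) w else 0).
  apply/funext => w; rewrite /overhead big_mkcond; congr (1 + _ * _).
  apply: eq_big_seq => y yX /=; rewrite yX indicE.
  case: eqP => [e|ne] /=; first by rewrite memNset ?mulr0 // => -[].
  by rewrite mem_set ?mulr1.
apply: measurable_funD; first exact: measurable_cst.
apply: measurable_funM; first exact: measurable_cst.
apply: measurable_sum => y.
case: (boolP (y \in X)) => [|_]; last exact: measurable_cst.
rewrite in_fsetI => /andP[yh yhu].
apply: measurable_funM; first exact: measurable_cst.
by apply/measurable_indic/measurable_neq_nat => k; [exact: mh|exact: mhu].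
Qed.

Lemma ge0_le_expectation_weighted_sum (R : realType) (d : measure_display)
    (T : measurableType d) (P : probability T R) (I : finType)
    (f : I -> T -> R) (c : I -> R) (a g : R) :
  0 <= a -> (forall i, 0 <= c i) ->
  (forall i, measurable_fun setT (f i)) -> (forall i w, 0 <= f i w) ->
  (forall w, a <= \sum_i c i * f i w) ->
  (forall i, ('E_P[f i] <= g%:E)%E) -> a <= (\sum_i c i) * g.
Proof.
move=> a0 c0 mf f0 le_a le_g; rewrite -lee_fin.
have -> : a%:E = (\int[P]_w (cst a%:E w))%E.
  by rewrite integral_cst //= probability_setT mule1.
apply: (@le_trans _ _ (\int[P]_w (\sum_i (c i)%:E * (f i w)%:E))%E).
  apply: ge0_le_integral => //.
  - apply: emeasurable_sum => i; apply: measurable_funeM.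
    exact/measurable_EFinP.
  - move=> w _; rewrite /cst /=; under eq_bigr do rewrite -EFinM.
    by rewrite sumEFin lee_fin.
rewrite ge0_integral_sum //; first last.
- by move=> i w _; rewrite mule_ge0 // lee_fin.
- by move=> i; apply: measurable_funeM; exact/measurable_EFinP.
rewrite mulr_suml -sumEFin; apply: lee_sum => i _.
rewrite ge0_integralZl_EFin //; first last.
- exact/measurable_EFinP.
- by move=> w _; rewrite lee_fin.
rewrite EFinM; apply: lee_wpmul2l; first by rewrite lee_fin.
by have := le_g i; rewrite unlock.
Qed.

Lemma admissible_load_factor (R : realType) (eps : R) L lo hi s :
  eps * L.+1%:R <= 1 -> admissible L lo hi s ->
  has_load_factor L.+1 (1 - eps) s.
Proof.
move=> epsL adm h r e; rewrite -natr_sum mulrBl mul1r lerBrDr.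
have := admissible_load adm e; rewrite -(ler_nat R) -[L.+1%:R]natr1.
by move: epsL; lra.
Qed.

Lemma series_harmonic_le_ln (R : realType) n :
  series harmonic n.+1 <= 1 + ln n.+1%:R :> R.
Proof.
elim: n => [|n IH]; first by rewrite /series /= big_nat1 ln1 invr1 addr0.
rewrite seriesSr /=; have n1_gt0 : 0 < n.+1%:R :> R by rewrite ltr0n.
have n2_gt0 : 0 < n.+2%:R :> R by rewrite ltr0n.
have ln_ratio : n.+2%:R^-1 <= ln n.+2%:R - ln n.+1%:R :> R.
  rewrite -ln_div ?posrE // -[_ / _]invrK invf_div lnV ?posrE ?divr_gt0 //.
  have -> : n.+1%:R / n.+2%:R = 1 + - n.+2%:R^-1 :> R.
    by rewrite -[n.+1%:R](addrK 1) natr1 mulrBl divff ?mul1r // lt0r_neq0.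
  by rewrite lerNr le_ln1Dx // ltrN2 invf_lt1 // ltr1n.
by apply: le_trans (lerD IH ln_ratio) _; rewrite -addrA subrKC.
Qed.

Lemma sum_inv_subn_le_ln (R : realType) n : (0 < n)%N ->
  \sum_(t < n.-1) (n - t.+1)%:R^-1 <= 1 + ln n%:R :> R.
Proof.
case: n => // n _; apply: le_trans (series_harmonic_le_ln R n).
rewrite (reindex_inj rev_ord_inj) /=.
rewrite (eq_bigr (fun i : 'I_n => harmonic i)) => [|i _]; last first.
  by congr (_%:R^-1); have := ltn_ord i; lia.
by rewrite -(big_mkord xpredT) seriesSr lerDl harmonic_ge0.
Qed.

Section MergingSquaredOverhead.
Variables (R : realType) (eps : R).
Variables (d : measure_display) (T : measurableType d) (P : probability T R).
Variables (A : strategy T) (n : nat).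
Hypothesis n_gt0 : (0 < n)%N.
Hypothesis alloc : is_allocator (1 - eps) A.
Hypothesis epsM : eps * (memory n)%:R <= 1.

Lemma allocates_admissible lo hi s : admissible (tight_size n n) lo hi s ->
  (forall w, is_allocation (memory n) (live s) (A (memory n) s w)) /\
  (forall x k, x \in live s ->
     measurable [set w | A (memory n) s w x = k]%classic).
Proof.
move=> adm.
apply: alloc => //; first exact: admissible_seq adm.
exact: admissible_load_factor epsM adm.
Qed.

Lemma measurable_merge_overhead (p : 'I_n.-1 * 'I_4) :
  measurable_fun setT (merge_overhead R A p).
Proof.
have [s merging_eq] := merging_split_update n (ltn_ord p.2) (ltn_ord p.1).
have := run_merging (_ : n.-1 < n)%N; rewrite ltn_predL => /(_ n_gt0).
move/run_admissible; rewrite merging_eq -cat_rcons => /admissible_prefix adm.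
apply: measurable_overhead => x k; last exact: (allocates_admissible adm).2.
move: adm; rewrite -cats1 => /admissible_prefix adm.
exact: (allocates_admissible adm).2.
Qed.

Lemma merging_overhead_bound (g : R) :
  (forall h u r, merging n n.-1 = h ++ u :: r ->
     ('E_P[fun w => (overhead R A (memory n) h u w ^+ 2)%R] <= g%:E)%E) ->
  n%:R ^+ 2 - 1 <= 12 ^+ 3 * n%:R * (\sum_(t < n.-1) (n - t.+1)%:R^-1) * g.
Proof.
move=> le_g.
have -> : 12 ^+ 3 * n%:R * (\sum_(t < n.-1) (n - t.+1)%:R^-1) =
    \sum_(p : 'I_n.-1 * 'I_4) 432 * n%:R / (n - p.1.+1)%:R :> R.
  rewrite -(pair_bigA _ (fun (t : 'I_n.-1) (r : 'I_4) =>
    432 * n%:R / (n - t.+1)%:R)) mulr_sumr /=; apply: eq_bigr => t _.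
  by rewrite sumr_const card_ord -mulr_natl; ring.
apply: (@ge0_le_expectation_weighted_sum _ _ _ P _
  (fun (p : 'I_n.-1 * 'I_4) w => merge_overhead R A p w ^+ 2))
  => [||p|p w|w|p].
- by rewrite subr_ge0 -natrX ler1n expn_gt0 n_gt0.
- by move=> p; rewrite divr_ge0 ?mulr_ge0 ?ler0n.
- exact/measurable_funX/measurable_merge_overhead.
- exact: sqr_ge0.
- apply: merging_overhead_ge => // t ltn.
  exact: (allocates_admissible (run_admissible (run_merging ltn))).1.
- have [s] := merging_split_update n (ltn_ord p.2) (ltn_ord p.1).
  exact: le_g.
Qed.

End MergingSquaredOverhead.

Lemma exists_natr_half (R : realType) (x : R) : 1 <= x ->
  exists2 n, (0 < n)%N & n%:R <= x <= 2 * n%:R.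
Proof.
move=> x1; exists (Num.truncn x); first by rewrite truncn_gt0.
have /andP[ge lt] : (Num.truncn x)%:R <= x < (Num.truncn x).+1%:R.
  by apply: truncn_itv; lra.
have n1 : 1 <= (Num.truncn x)%:R :> R by rewrite ler1n truncn_gt0.
by rewrite ge /=; move: lt; rewrite -natr1; lra.
Qed.

Lemma natr_memory (R : realType) n :
  (memory n)%:R = 2 * n%:R ^+ 2 + 4 * n%:R + 1 :> R.
Proof.
rewrite -natrX -!natrM -!natrD natr1; congr (_%:R).
by rewrite /memory /tight_size; lia.
Qed.

Lemma memory_le_expn7 (R : realType) (y : R) n :
  7 <= y -> (0 < n)%N -> n%:R <= y ^+ 3 -> (memory n)%:R <= y ^+ 7.
Proof.
move=> y7 n0 ny; have n1 : 1 <= n%:R :> R by rewrite ler1n.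
have y0 : 0 <= y by lra.
apply: (@le_trans _ _ (7 * n%:R ^+ 2)); first by rewrite natr_memory; nra.
rewrite (exprS y 6) (exprM y 3 2) ler_pM ?sqr_ge0 //.
by rewrite lerXn2r ?nnegrE ?exprn_ge0.
Qed.

Lemma merging_sizes_within (R : realType) (x : R) n t :
  (t < n)%N -> n%:R <= x <= 2 * n%:R ->
  sizes_within (2^-1 * x^-1 * (memory n)%:R) (6 * x^-1 * (memory n)%:R)
    (merging n t).
Proof.
move=> lttn /andP[nx xn] o.
move=> /(admissible_size (run_admissible (run_merging lttn))) /andP[lo hi].
have n0 : (0 < n)%N := leq_ltn_trans (leq0n t) lttn.
have n1 : 1 <= n%:R :> R by rewrite ler1n.
have x0 : 0 < x by lra.
have {}lo : 2 * n%:R + 2 <= (mu o)%:R :> R.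
  by rewrite -natrM -natrD ler_nat; lia.
have {}hi : (mu o)%:R <= 6 * n%:R + 6 :> R.
  by rewrite -natrM -natrD ler_nat; lia.
rewrite natr_memory -!mulrA ![x^-1 * _]mulrC !mulrA.
by apply/andP; rewrite ler_pdivrMr // ler_pdivlMr //; split; nra.
Qed.

Lemma sqr_le_overhead_bound (R : realType) (y g : R) n :
  7 <= y -> n%:R <= y ^+ 3 <= 2 * n%:R ->
  n%:R ^+ 2 - 1 <= 12 ^+ 3 * n%:R * (\sum_(t < n.-1) (n - t.+1)%:R^-1) * g ->
  y ^+ 2 <= 12 ^+ 4 * g.
Proof.
move=> y7 /andP[ny yn]; set H := \sum_(t < _) _ => overhead_le.
have y0 : 0 < y by lra.
have n2 : 2 <= n%:R :> R.
  have : 7 ^+ 3 <= y ^+ 3 by rewrite lerXn2r ?nnegrE //; lra.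
  by lra.
have n0 : (0 < n)%N by rewrite -(ltr_nat R); lra.
have H0 : 0 <= H by apply: sumr_ge0 => t _; rewrite invr_ge0.
have ln_le : ln y <= y - 1.
  by rewrite -[X in ln X](subrKC 1) le_ln1Dx //; lra.
have H_le : H <= 3 * y.
  apply: le_trans (sum_inv_subn_le_ln R n0) _.
  have : ln n%:R <= ln (y ^+ 3) by rewrite ler_ln ?posrE ?exprn_gt0 ?ltr0n.
  by rewrite lnXn // -mulr_natl; lra.
have g0 : 0 < g.
  rewrite ltNge; apply/negP => g_le0.
  have : 12 ^+ 3 * n%:R * H * g <= 0 by rewrite mulr_ge0_le0 // !mulr_ge0.
  by nra.
have n_le : n%:R <= 2 * 12 ^+ 3 * (3 * y) * g.
  have : H * g <= 3 * y * g by rewrite ler_pM2r.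
  rewrite -(@ler_pM2l _ n%:R); last by lra.
  move: overhead_le; set c := 12 ^+ 3.
  have : 0 < c by rewrite exprn_gt0.
  by nra.
by rewrite -(ler_pM2l y0) -exprS; apply: le_trans yn _; move: n_le; lra.
Qed.

Lemma powR_natr_div (R : realType) (a : R) k m : 0 <= a ->
  a `^ (k%:R / m%:R) = (a `^ (- (1 / m%:R)) ^+ k)^-1.
Proof.
move=> a0; rewrite -powR_mulrn ?powR_ge0 // -powRrM -powRN.
by congr (_ `^ _); rewrite mulNr opprK mul1r mulrC.
Qed.

Theorem theorem1p4 (R : realType) :
  exists c c1 c2 eps0 : R,
    (0 < c /\ 0 < c1 /\ 0 < c2 /\ 0 < eps0) /\
    forall eps : R, 0 < eps < eps0 ->
    forall (d : measure_display) (T : measurableType d) (P : probability T R)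
           (A : strategy T) (g : R -> R),
      is_allocator (1 - eps) A ->
      (forall (M : nat) (s : seq update),
         (0 < M)%N ->
         update_sequence s ->
         has_load_factor M (1 - eps) s ->
         sizes_within (c1 * eps `^ (3 / 7) * M%:R)
                      (c2 * eps `^ (3 / 7) * M%:R) s ->
         forall h u r, s = h ++ u :: r ->
           ('E_P[fun w => (overhead R A M h u w ^+ 2)%R] <= (g eps)%:E)%E) ->
      c * eps `^ (- (1 / 7)) <= g eps.
Proof.
exists (12^-1 ^+ 4), 2^-1, 6, (7^-1 ^+ 7).
split; first by rewrite !exprn_gt0 ?invr_gt0.
move=> eps /andP[eps0 eps_lt] d T P A g alloc overhead_le.
set y := eps `^ (- (1 / 7)); have y0 : 0 < y by apply: powR_gt0.
have yX k : eps `^ (k%:R / 7) = (y ^+ k)^-1 := powR_natr_div k 7 (ltW eps0).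
have epsE : eps = (y ^+ 7)^-1 by rewrite -yX divff ?powRr1 // ltW.
have y7 : 7 <= y.
  rewrite -lef_pV2 ?posrE // -(@ler_pXn2r _ 7) ?nnegrE ?invr_ge0 ?(ltW y0) //.
  by rewrite [y^-1 ^+ 7]exprVn -epsE ltW.
have y1 : 1 <= y by lra.
rewrite exprVn ler_pdivrMl ?exprn_gt0 //; rewrite (yX 3%N) in overhead_le.
have [n n0 ny] := exists_natr_half (exprn_ege1 3 y1).
have epsM : eps * (memory n)%:R <= 1.
  rewrite epsE ler_pdivrMl ?exprn_gt0 // mulr1.
  by apply: memory_le_expn7 => //; case/andP: ny.
have ltn : (n.-1 < n)%N by rewrite ltn_predL.
have adm := run_admissible (run_merging ltn).
apply: le_trans (ler_eXnr _ y1) (sqr_le_overhead_bound y7 ny _) => //.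
apply: (merging_overhead_bound n0 alloc epsM (P := P)).
exact: overhead_le (admissible_seq adm) (admissible_load_factor epsM adm)
  (merging_sizes_within ltn ny).
Qed.
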